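(* For every $n\in\{1,2,\dots\}$, the sequence of iterated sequential closures of the cone $\operatorname{cc}(M_n)$ in $E$ terminates precisely after $n$ steps at $$\overline{\operatorname{cc}(M_n)}=\bigoplus_{i=0}^{\infty}\mathbb{R}_{\ge 0}\cdot e_i.$$ That is, setting $C_0=\operatorname{cc}(M_n)$ and $C_{k+1}=(C_k)^{\ddagger}$ for $k\ge 0$, one has $C_n=\overline{\operatorname{cc}(M_n)}=\bigoplus_{i=0}^{\infty}\mathbb{R}_{\ge 0}\cdot e_i$ and $C_{n-1}\neq C_n$.
   Context: $E=\bigoplus_{i=0}^{\infty}\mathbb{R}\cdot e_i$ is the real vector space of real sequences $(f_i)_{i\in\mathbb{N}}$ ($\mathbb{N}=\{0,1,2,\dots\}$) with only finitely many nonzero entries, endowed with the finest locally convex topology (the vector space topology for which all convex, absorbent, symmetric subsets form a zero neighborhood base; $U$ is absorbent if for each $x$ there is $\lambda>0$ with $x\in\lambda U$, and symmetric if $\lambda U\subseteq U$ for all $|\lambda|\le 1$). For $C\subseteq E$, $\overline{C}$ is the closure of $C$, and $C^{\ddagger}$ (the sequential closure) is the set of limits in $E$ of sequences of elements of $C$. For $n\ge 1$ and $l=(l_0,l_1,\dots,l_n)\in(\mathbb{N}\setminus\{0\})^{n+1}$ let $$V(l)=\Big[\tfrac1{l_1},1\Big]^{l_0}\times\Big[\tfrac1{l_2},1\Big]^{l_1}\times\cdots\times\Big[\tfrac1{l_n},1\Big]^{l_{n-1}},$$ regarded as a subset of the span of $e_0,\dots,e_{l_0+\cdots+l_{n-1}-1}$,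 and let $U(l)=V(l)\times\bigoplus_{i=l_0+\cdots+l_{n-1}}^{\infty}[0,1]\cdot e_i\subseteq E$, i.e. the set of finitely supported sequences whose first $l_0+\cdots+l_{n-1}$ coordinates form an element of $V(l)$ and whose remaining coordinates lie in $[0,1]$. Put $M_n=\bigcup_{l\in(\mathbb{N}\setminus\{0\})^{n+1}}U(l)$. $\operatorname{cc}(M_n)$ denotes the cone generated by $M_n$, i.e. the set of all finite linear combinations of elements of $M_n$ with nonnegative coefficients, including $0$. $\bigoplus_{i=0}^{\infty}\mathbb{R}_{\ge0}\cdot e_i$ is the set of elements of $E$ with all coordinates nonnegative. *)

(* Defs.v *)
From HB Require Import structures.
From mathcomp Require Import all_boot all_order all_algebra.
From mathcomp Require Import all_classical all_reals all_analysis.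
Set Implicit Arguments.
Unset Strict Implicit.
Unset Printing Implicit Defensive.
Import Order.TTheory GRing.Theory Num.Theory.
Import numFieldNormedType.Exports.
Local Open Scope classical_set_scope.
Local Open Scope ring_scope.
Local Open Scope convex_scope.

Section FinestLocallyConvex.
Variables (R : realType) (E : lmodType R).
Implicit Types (U V A B : set E) (x y : E).

Definition absorbent U :=
  forall x, exists2 lam : R, 0 < lam & ( *:%R lam @` U) x.

Definition symmetric_set U :=
  forall lam : R, `|lam| <= 1 -> *:%R lam @` U `<=` U.

Definition fine_base : set_system E :=
  [set U | [/\ convex_set U, absorbent U & symmetric_set U]].

Definition fine_nbhs x : set_system E :=
  [set A | exists2 U, fine_base U & +%R x @` U `<=` A].

Lemma convex_setP A : convex_set A <->
  forall x y (t : R), 0 <= t -> t <= 1 -> A x -> A y ->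
    A (t *: x + (1 - t) *: y).
Proof.
split=> [cA x y t t0 t1 Ax Ay|cA x y t /[!inE] Ax Ay].
  have tP : Itv.spec (@Itv.num_sem R) (Itv.Real `[0%Z, 1%Z]) t.
    by rewrite /= /Itv.num_sem num_real/= in_itv/= t0 t1.
  by have := cA x y (Itv.mk tP); rewrite !inE; apply.
by apply: cA.
Qed.

Lemma fine_base0 U : fine_base U -> U 0.
Proof.
by move=> [_ /(_ 0)[l _ [u Uu _]] /(_ 0)]; apply; [rewrite normr0|exists u; rewrite ?scale0r].
Qed.

Lemma fine_baseT : fine_base setT.
Proof.
split=> [|x|//]; first exact/convex_setP.
by exists 1 => //; exists x => //; rewrite scale1r.
Qed.

Lemma fine_baseI U V : fine_base U -> fine_base V -> fine_base (U `&` V).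
Proof.
move=> [/convex_setP cU aU sU] [/convex_setP cV aV sV]; split.
- apply/convex_setP => x y t t0 t1 [Ux Vx] [Uy Vy].
  by split; [exact: cU|exact: cV].
- move=> x; have [l l0 [u Uu lu]] := aU x; have [m m0 [v Vv mv]] := aV x.
  have k0 : 0 < l + m by rewrite addr_gt0.
  exists (l + m) => //; exists ((l + m)^-1 *: x).
    split.
    + apply: (sU (l / (l + m))); last by exists u => //; rewrite -lu scalerA mulrC.
      by rewrite gtr0_norm ?divr_gt0// ler_pdivrMr// mul1r lerDl ltW.
    + apply: (sV (m / (l + m))); last by exists v => //; rewrite -mv scalerA mulrC.
      by rewrite gtr0_norm ?divr_gt0// ler_pdivrMr// mul1r lerDr ltW.
  by rewrite scalerA divff ?gt_eqF// scale1r.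
- by move=> l l1 _ [x [Ux Vx] <-]; split; [apply: sU l1 _ _|apply: sV l1 _ _];
    exists x.
Qed.

Lemma fine_baseZ (r : R) U : 0 < r -> fine_base U -> fine_base ( *:%R r @` U).
Proof.
move=> r0 [/convex_setP cU aU sU]; split.
- apply/convex_setP => _ _ t t0 t1 [x Ux <-] [y Uy <-].
  exists (t *: x + (1 - t) *: y); first exact: cU.
  by rewrite scalerDr !scalerA !(mulrC r).
- move=> x; have [l l0 [u Uu <-]] := aU x.
  exists (l / r); first by rewrite divr_gt0.
  by exists (r *: u); [exists u|rewrite scalerA divfK// gt_eqF].
- move=> l l1 _ [_ [x Ux <-] <-]; exists (l *: x); first by apply: sU l1 _ _; exists x.
  by rewrite !scalerA mulrC.
Qed.

Lemma fine_base_half U x y : fine_base U -> U x -> U y ->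
  U (2^-1 *: x + 2^-1 *: y).
Proof.
move=> [/convex_setP cU _ _] Ux Uy.
rewrite -[X in _ + X *: y](_ : 1 - 2^-1 = 2^-1); last first.
  by apply/eqP; rewrite subr_eq -div1r -splitr.
by apply: cU; rewrite // ?invr_ge0// invf_le1// ler1n.
Qed.

Lemma fine_nbhs_filter x : ProperFilter (fine_nbhs x).
Proof.
apply: Build_ProperFilter_ex => [A [U bU UA]|].
  by exists (x + 0); apply: UA; exists 0 => //; exact: fine_base0.
split.
- by exists setT => //; exact: fine_baseT.
- move=> A B [U bU UA] [V bV VB]; exists (U `&` V); first exact: fine_baseI.
  by move=> _ [u [Uu Vu] <-]; split; [apply: UA|apply: VB]; exists u.
- by move=> A B AB [U bU UA]; exists U => // y /UA/AB.
Qed.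

Lemma fine_nbhs_singleton x A : fine_nbhs x A -> A x.
Proof.
by move=> [U bU]; apply; exists 0; [exact: fine_base0|rewrite addr0].
Qed.

Lemma fine_nbhs_nbhs x A : fine_nbhs x A -> fine_nbhs x (fine_nbhs^~ A).
Proof.
move=> [U bU UA]; have hU : fine_base ( *:%R 2^-1 @` U).
  by apply: fine_baseZ; rewrite ?invr_gt0.
exists ( *:%R 2^-1 @` U) => // _ [_ [u Uu <-] <-].
exists ( *:%R 2^-1 @` U) => // _ [_ [v Uv <-] <-].
apply: UA; exists (2^-1 *: u + 2^-1 *: v); last by rewrite addrA.
exact: fine_base_half.
Qed.

End FinestLocallyConvex.

(* {poly R} is the type of finitely supported sequences in R, stored without   *)
(* trailing zeros, with coordinatewise addition and scaling: the coordinate    *)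
(* f_i is f`_i and e_i is 'X^i.  The product of polynomials plays no role.     *)
Definition finSeq (R : realType) : Type := {poly R}.

Section FinSeqTopology.
Variable R : realType.
Local Notation E := (finSeq R).

HB.instance Definition _ := GRing.Lmodule.copy E {poly R}.
HB.instance Definition _ := isPointed.Build E 0.
HB.instance Definition _ := hasNbhs.Build E (@fine_nbhs R E).
HB.instance Definition _ := Nbhs_isNbhsTopological.Build E
  (@fine_nbhs_filter R E) (@fine_nbhs_singleton R E) (@fine_nbhs_nbhs R E).

Let finSeq_add_continuous : continuous (fun z : E * E => z.1 + z.2).
Proof.
move=> [x y] A [U bU UA] /=.
have hU : fine_base ( *:%R 2^-1 @` U).
  by apply: fine_baseZ; rewrite ?invr_gt0.
exists (+%R x @` ( *:%R 2^-1 @` U), +%R y @` ( *:%R 2^-1 @` U)).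
  by split; exists ( *:%R 2^-1 @` U).
move=> [p q] /= [[_ [u Uu <-] <-] [_ [v Uv <-] <-]].
apply: UA; exists (2^-1 *: u + 2^-1 *: v); first exact: fine_base_half.
by rewrite addrACA.
Qed.

Let finSeq_scale_continuous : continuous (fun z : R^o * E => z.1 *: z.2).
Proof.
move=> [a x] A [U bU UA] /=.
have [_ /(_ x)[l l0 [w Uw lw]] sU] := bU.
pose d : R := Num.min 1 (2 * l)^-1.
have d0 : 0 < d by rewrite lt_min ltr01 invr_gt0 mulr_gt0.
pose r : R := (2 * (`|a| + 1))^-1.
have a1 : 0 < `|a| + 1 by rewrite ltr_wpDl.
have r0 : 0 < r by rewrite invr_gt0 mulr_gt0.
exists (ball (a : R^o) d, +%R x @` ( *:%R r @` U)).
  split; first exact: nbhsx_ballx.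
  by exists ( *:%R r @` U) => //; exact: fine_baseZ.
move=> [b q] /= [ab [_ [u Uu <-] <-]].
rewrite -ball_normE/= in ab.
have ab1 : `|b - a| <= 1.
  by rewrite distrC ltW// (lt_le_trans ab)// ge_min lexx.
have abl : `|b - a| <= (2 * l)^-1.
  by rewrite distrC ltW// (lt_le_trans ab)// ge_min lexx orbT.
apply: UA.
exists (2^-1 *: ((2 * (b - a) * l) *: w) + 2^-1 *: ((2 * b * r) *: u)).
  apply: fine_base_half => //.
  - apply: (sU (2 * (b - a) * l)); last by exists w.
    rewrite !normrM (gtr0_norm l0) ger0_norm// mulrAC.
    by rewrite mulrC -ler_pdivlMr ?mulr_gt0// mul1r.
  - apply: (sU (2 * b * r)); last by exists u.
    rewrite !normrM (gtr0_norm r0) ger0_norm// ler_pdivrMr ?mulr_gt0// mul1r.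
    rewrite ler_pM2l// -[b](subrK a) addrC.
    by rewrite (le_trans (ler_normD _ _))// lerD2l.
rewrite !scalerA !mulrA mulVf// !mul1r -scalerA lw scalerBl.
by rewrite addrA (addrC (a *: x)) subrK scalerDr scalerA.
Qed.

Let finSeq_locally_convex :
  exists2 B : set_system E, (forall b, b \in B -> convex_set b) & basis B.
Proof.
exists [set b : set E | open b /\ convex_set b]; first by move=> b /[!inE] -[].
split=> [b []//|x A [U bU UA]].
exists (interior (+%R x @` U)); last first.
  by move=> y /interior_subset/UA.
split; last by exists U.
split; first exact: open_interior.
have [/convex_setP cU _ _] := bU.
apply/convex_setP => y z t t0 t1 [V bV Vy] [W bW Wz].
exists (V `&` W); first exact: fine_baseI.
move=> _ [v [Vv Wv] <-].
have [|u Uu xu] := Vy (y + v); first by exists v.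
have [|u' Uu' xu'] := Wz (z + v); first by exists v.
exists (t *: u + (1 - t) *: u'); first exact: cU.
have -> : v = t *: v + (1 - t) *: v by rewrite -scalerDl addrC subrK scale1r.
by rewrite addrACA -!scalerDr -xu -xu' !scalerDr addrACA -scalerDl (addrC t)
  subrK scale1r.
Qed.

(* This factory only supplies the uniform structure. *)
HB.instance Definition _ := PreTopologicalLmod_isTvs.Build R E
  finSeq_add_continuous finSeq_scale_continuous finSeq_locally_convex.
HB.instance Definition _ :=
  PreTopologicalNmodule_isTopologicalNmodule.Build E finSeq_add_continuous.
HB.instance Definition _ :=
  TopologicalNmodule_isTopologicalLmodule.Build R E finSeq_scale_continuous.
HB.instance Definition _ := Uniform_isTvs.Build R E finSeq_locally_convex.

End FinSeqTopology.

Definition entry (R : realType) (f : finSeq R) (i : nat) : R :=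
  (f : {poly R})`_i.

Definition cc (R : realType) (E : lmodType R) (A : set E) : set E :=
  [set x | exists m (c : 'I_m -> R) (a : 'I_m -> E),
    [/\ forall i, 0 <= c i, forall i, A (a i) & x = \sum_(i < m) c i *: a i]].

Definition seq_closure (T : topologicalType) (C : set T) : set T :=
  [set x | exists2 u : nat -> T, forall k, C (u k) & u @ \oo --> x].

(* block l j = l_0 + ... + l_(j-1), so that the factor [1/l_(j+1), 1]^(l_j) of *)
(* V(l) occupies the coordinates i with block l j <= i < block l (j+1).        *)
Definition block (n : nat) (l : n.+1.-tuple nat) (j : nat) : nat :=
  (\sum_(k < j) nth 0 l k)%N.

Definition V_set (R : realType) (n : nat) (l : n.+1.-tuple nat) : set (finSeq R) :=
  [set v | (forall j i : nat, (j < n)%N -> (block l j <= i < block l j.+1)%N ->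
              (nth 0%N l j.+1)%:R^-1 <= entry v i <= 1) /\
           (forall i : nat, (block l n <= i)%N -> entry v i = 0)].

(* take_poly N f keeps the coordinates f_i with i < N and zeroes the others. *)
Definition U_set (R : realType) (n : nat) (l : n.+1.-tuple nat) : set (finSeq R) :=
  [set f | V_set l (take_poly (block l n) f : finSeq R) /\
           (forall i : nat, (block l n <= i)%N -> 0 <= entry f i <= 1)].

Definition M_set (R : realType) (n : nat) : set (finSeq R) :=
  \bigcup_(l in [set l : n.+1.-tuple nat | forall i, (0 < tnth l i)%N]) @U_set R n l.

Arguments M_set : clear implicits.

Definition nonneg_orthant (R : realType) : set (finSeq R) :=
  [set f | forall i, 0 <= entry f i].

Arguments nonneg_orthant : clear implicits.

(* Main.v *)
Require Import Defs.
From mathcomp Require Import all_boot all_order all_algebra.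
From mathcomp Require Import all_classical all_reals all_analysis.
Import Order.TTheory GRing.Theory Num.Theory.
Import numFieldNormedType.Exports.
Local Open Scope classical_set_scope.
Local Open Scope ring_scope.

(** Taking the sequential closure of the cone removes one level of the
    construction:
      [seq_closure (cc (M_set R n.+1)) = cc (M_set R n)] for every [n >= 0]
    ([seq_closure_cc_M]). Since [M_set R 0] consists of all elements with
    entries in [0, 1], its cone is the whole orthant ([cc_M0]); hence the [k]-th
    iterated closure of [cc (M_set R n)] is [cc (M_set R (n - k))], and the
    [n]-th one is the orthant. The orthant is closed, so it is also the
    topological closure. The step before it is [cc (M_set R 1)], which misses
    [e_1]: an element of this cone whose entry 0 vanishes is zero
    ([cc_M1_neq]).

    For the inclusion of [cc (M_set R n)] in the sequential closure, an element
    [f] of [U_set l] is moved towards the indicator of its first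
    [block l n.+1] coordinates by the factor [1 / (k + 1)]. The result lies in
    [U_set (l, k + 1)] and converges to [f] ([U_segment]).

    For the other inclusion, a convergent sequence of [cc (M_set R n.+1)] has
    its supports in some fixed [{0, ..., N - 1}] ([cvg_bounded_support]). The
    entries in the blocks of an element of [U_set l] are nonzero, so only
    elements with [l_0, ..., l_n <= N] can contribute. Forgetting the unbounded
    parameter [l_(n+1)], every term is thus a sum of elements of the finitely
    many cones over the sets [U_set (l_0, ..., l_n)] of level [n]
    ([cc_M_decomposition]). These cones are cut out by non-strict inequalities
    between entries ([block_cone]), and the summands are bounded because all
    entries are nonnegative. So a limit of the summands decomposes the limit of
    the sequence ([seq_closure_cc_M_sub]). *)

(** * Cones *)

Section Cones.
#[local] Set Implicit Arguments.
#[local] Unset Strict Implicit.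
Variables (R : realType) (E : lmodType R).
Implicit Types (A K : set E) (x y : E).

Lemma cc0 A : cc A 0.
Proof.
exists 0%N, (fun=> 0), (fun=> 0); split => [i|[]//|]; first exact: lexx.
by rewrite big_ord0.
Qed.

Lemma ccD A x y : cc A x -> cc A y -> cc A (x + y).
Proof.
move=> [m [c [a [c0 aA ->]]]] [p [d [b [d0 bA ->]]]].
exists (m + p)%N,
  (fun i => match fintype.split i with inl j => c j | inr j => d j end),
  (fun i => match fintype.split i with inl j => a j | inr j => b j end).
split=> [i|i|]; [by case: (fintype.split i)|by case: (fintype.split i)|].
rewrite big_split_ord/=; congr (_ + _); apply: eq_bigr => i _.
  by case: split_ordP => j /eqP; rewrite ?eq_lshift ?eq_lrshift// => /eqP->.
by case: split_ordP => j /eqP; rewrite ?eq_rshift ?eq_rlshift// => /eqP->.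
Qed.

Lemma ccZ A (c : R) x : 0 <= c -> A x -> cc A (c *: x).
Proof.
move=> c0 Ax; exists 1%N, (fun=> c), (fun=> x); split=> //.
by rewrite big_ord_recl big_ord0 addr0.
Qed.

Lemma cc_sum A (I : finType) (g : I -> E) :
  (forall i, cc A (g i)) -> cc A (\sum_i g i).
Proof. by move=> Ag; apply: big_ind => //; [exact: cc0|exact: ccD]. Qed.

Lemma cc_min A K : K 0 -> (forall x y, K x -> K y -> K (x + y)) ->
  (forall (c : R) a, 0 <= c -> A a -> K (c *: a)) -> cc A `<=` K.
Proof.
move=> K0 KD KZ _ [m [c [a [c0 aA ->]]]].
by apply: big_ind => // i _; exact: KZ.
Qed.

End Cones.

(** * The finest locally convex topology on finitely supported sequences *)

Section FinestTopology.
#[local] Set Implicit Arguments.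
#[local] Unset Strict Implicit.
Variable R : realType.
Local Notation E := (finSeq R).
Implicit Types (f x y : E) (u : nat -> E) (eps : nat -> R).

Lemma entryD f x i : entry (f + x) i = entry f i + entry x i.
Proof. exact: coefD. Qed.

Lemma entryB f x i : entry (f - x) i = entry f i - entry x i.
Proof. exact: coefB. Qed.

Lemma entryZ (c : R) f i : entry (c *: f) i = c * entry f i.
Proof. exact: coefZ. Qed.

Lemma entry0 i : entry (0 : E) i = 0.
Proof. exact: coef0. Qed.

Lemma entry_sum (I : finType) (g : I -> E) i :
  entry (\sum_k g k) i = \sum_k entry (g k) i.
Proof. exact: coef_sum. Qed.

Lemma entryP f x : entry f =1 entry x -> f = x.
Proof. by move=> fx; apply/polyP. Qed.

Definition box eps : set E := [set f | forall i, `|entry f i| <= eps i].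

(** The half-widths may tend to 0: an element has finitely many nonzero
    entries, so the box absorbs it. *)
Lemma fine_base_box eps : (forall i, 0 < eps i) -> fine_base (box eps).
Proof.
move=> eps0; split.
- apply/convex_setP => x y t t0 t1 xe ye i; rewrite entryD !entryZ.
  rewrite (le_trans (ler_normD _ _))// !normrM (ger0_norm t0).
  rewrite (@ger0_norm _ (1 - t)) ?subr_ge0//.
  have -> : eps i = t * eps i + (1 - t) * eps i.
    by rewrite -mulrDl addrC subrK mul1r.
  by rewrite lerD// ler_wpM2l// subr_ge0.
- move=> x; pose S := \sum_(j < size (x : {poly R})) `|entry x j| / eps j.
  have S0 : 0 <= S by apply: sumr_ge0 => j _; rewrite divr_ge0// ltW.
  have l0 : 0 < 1 + S by rewrite ltr_wpDr.
  exists (1 + S) => //; exists ((1 + S)^-1 *: x); last first.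
    by rewrite scalerA divff ?gt_eqF// scale1r.
  move=> i; rewrite entryZ normrM gtr0_norm ?invr_gt0// mulrC.
  rewrite ler_pdivrMr// mulrC -ler_pdivrMr//.
  have [ix|xi] := ltnP i (size (x : {poly R})).
    rewrite ler_wpDl// /S (bigD1 (Ordinal ix))//= lerDl sumr_ge0// => j _.
    by rewrite divr_ge0// ltW.
  by rewrite /entry nth_default// normr0 mul0r ltW.
- move=> l l1 _ [x xe <-] i; rewrite entryZ normrM.
  by rewrite (le_trans _ (xe i))// ler_piMl.
Qed.

Lemma nbhs_box x eps : (forall i, 0 < eps i) ->
  nbhs x [set f | forall i, `|entry f i - entry x i| <= eps i].
Proof.
move=> eps0; exists (box eps); first exact: fine_base_box.
by move=> _ [u ue <-] i; rewrite entryD addrC addKr.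
Qed.

Lemma entry_continuous i : continuous (fun f : E => entry f i).
Proof.
move=> x; apply/(@cvgrPdist_le _ _ _ _ (nbhs_filter x)) => e e0.
apply: (filterS _ (@nbhs_box x (fun=> e) (fun=> e0))) => f /(_ i).
by rewrite distrC.
Qed.

(** A convergent sequence for the finest locally convex topology lives in a
    finite-dimensional subspace: if infinitely many degrees [i] occurred as top
    degree of differences [u k - x], then a box whose [i]-th half-width is half
    of the corresponding leading coefficient would exclude infinitely many
    terms. *)
Lemma cvg_bounded_support u x : u @ \oo --> x ->
  exists N, forall k i, (N <= i)%N -> entry (u k) i = 0.
Proof.
move=> ux; pose d k : {poly R} := u k - x.
have /choice[kap kapP] i : exists k',
    (exists k, size (d k) = i.+1) -> size (d k') = i.+1.
  have [[k dk]|nk] := pselect (exists k, size (d k) = i.+1); first by exists k.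
  by exists 0%N.
pose eps i := if size (d (kap i)) == i.+1 then `|(d (kap i))`_i| / 2 else 1.
have lead0 i : size (d (kap i)) = i.+1 -> 0 < `|(d (kap i))`_i|.
  move=> di; rewrite normr_gt0.
  have := lead_coef_eq0 (d (kap i)).
  by rewrite lead_coefE di/= => ->; rewrite -size_poly_eq0 di.
have eps0 i : 0 < eps i.
  by rewrite /eps; case: eqP => // /lead0 ?; rewrite divr_gt0.
(* From rank [K] on the differences lie in the box, so any top degree beyond
   those of the first [K] differences would be realized by a difference inside
   the box, whose leading coefficient would be at most half of itself. *)
have [K _ KP] := ux _ (nbhs_box x eps0).
pose N0 := (\max_(k < K) size (d k))%N.
have dK k : (k < K)%N -> (size (d k) <= N0)%N.
  by move=> kK; exact: (leq_bigmax (Ordinal kK)).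
have dN k : (size (d k) <= N0)%N.
  rewrite leqNgt; apply/negP => Nk.
  have [i dk] : exists i, size (d k) = i.+1.
    by exists (size (d k)).-1; rewrite prednK// (leq_ltn_trans _ Nk).
  have di := kapP i (ex_intro _ k dk).
  have Ki : (K <= kap i)%N.
    by rewrite leqNgt; apply/negP => /dK; rewrite di -dk leqNgt Nk.
  have := KP _ Ki i; rewrite -entryB /eps di eqxx.
  rewrite -[entry _ _]/((d (kap i))`_i) ler_pdivlMr// ger_pMr ?lead0//.
  by rewrite lern1.
exists (maxn N0 (size (x : {poly R}))) => k i; rewrite geq_max => /andP[Ni xi].
have := nth_default 0 (leq_trans (dN k) Ni).
by rewrite -[_`_i]/(entry (u k - x) i) entryB [entry x i]nth_default// subr0.
Qed.

(** The segment from [x] to [y] enters every neighborhood of [x] because the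
    basic neighborhoods are absorbent. *)
Lemma cvg_to_segment x y : (fun k => x + k.+1%:R^-1 *: (y - x)) @ \oo --> x.
Proof.
move=> A [U [cU aU sU] UA]; have [l l0 [w Uw lw]] := aU (y - x).
have lK := archi_boundP (ltW l0); set K := Num.bound l in lK.
exists K => // k /= Kk; apply: UA; exists (k.+1%:R^-1 *: (y - x)) => //.
apply: (sU (l / k.+1%:R)); last by exists w => //; rewrite -lw scalerA mulrC.
rewrite gtr0_norm ?divr_gt0// ler_pdivrMr// mul1r ltW// (lt_le_trans lK)//.
by rewrite ler_nat ltnW.
Qed.

End FinestTopology.

(** * Blocks and the cones over them *)

Section Blocks.
#[local] Set Implicit Arguments.
#[local] Unset Strict Implicit.
Variable R : realType.
Local Notation E := (finSeq R).
Implicit Types (f : E) (n : nat).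

Lemma blockS n (l : n.+1.-tuple nat) j :
  block l j.+1 = (block l j + nth 0%N l j)%N.
Proof. by rewrite /block big_ord_recr. Qed.

Lemma block_le n (l : n.+1.-tuple nat) i j :
  (i <= j)%N -> (block l i <= block l j)%N.
Proof.
move=> /subnKC <-; elim: (j - i)%N => [|k IH]; first by rewrite addn0.
by rewrite addnS blockS (leq_trans IH)// leq_addr.
Qed.

Lemma block_cover n (l : n.+1.-tuple nat) m i : (i < block l m)%N ->
  exists2 j, (j < m)%N & (block l j <= i < block l j.+1)%N.
Proof.
elim: m => [|m IH]; first by rewrite /block big_ord0.
move=> im; have [|mi] := ltnP i (block l m); last by exists m; rewrite ?mi.
by move=> /IH[j jm ij]; exists j => //; exact: ltnW.
Qed.

Lemma leq_nth_block n (l : n.+1.-tuple nat) j m : (j < m)%N ->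
  (nth 0%N l j <= block l m)%N.
Proof.
by move=> jm; rewrite (leq_trans _ (block_le _ jm))// blockS leq_addl.
Qed.

Lemma eq_block n n' (l : n.+1.-tuple nat) (l' : n'.+1.-tuple nat) m :
  (forall j, (j < m)%N -> nth 0%N l j = nth 0%N l' j) ->
  forall j, (j <= m)%N -> block l j = block l' j.
Proof.
move=> ll' j jm; apply: eq_bigr => k _; rewrite ll'//.
exact: leq_trans (ltn_ord k) jm.
Qed.

Definition pos_tuple n (l : n.+1.-tuple nat) :=
  forall j, (j <= n)%N -> (0 < nth 0%N l j)%N.

Lemma pos_tupleP n (l : n.+1.-tuple nat) :
  (forall i, (0 < tnth l i)%N) <-> pos_tuple l.
Proof.
split=> [l0 j jn|l0 i]; last by rewrite (tnth_nth 0%N) l0// -ltnS.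
by have := l0 (Ordinal (jn : (j < n.+1)%N)); rewrite (tnth_nth 0%N).
Qed.

Lemma U_setP n (l : n.+1.-tuple nat) f : U_set l f <->
  (forall i, 0 <= entry f i <= 1) /\
  (forall j i, (j < n)%N -> (block l j <= i < block l j.+1)%N ->
     (nth 0%N l j.+1)%:R^-1 <= entry f i).
Proof.
have lt_blk j i : (j < n)%N -> (block l j <= i < block l j.+1)%N ->
    (i < block l n)%N.
  by move=> jn /andP[_ ij]; rewrite (leq_trans ij)// block_le.
have etake i : entry (take_poly (block l n) (f : {poly R}) : E) i =
    if (i < block l n)%N then entry f i else 0 by exact: coef_take_poly.
split=> [[[Vf _] f01]|[f01 lf]].
  split=> [i|j i jn ij].
    have [in_|] := ltnP i (block l n); last exact: f01.
    have [j jn ij] := block_cover in_.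
    have := Vf j i jn ij; rewrite etake in_ => /andP[le1 ->].
    by rewrite (le_trans _ le1)// invr_ge0.
  by have := Vf j i jn ij; rewrite etake (lt_blk j i)// => /andP[].
split=> [|i _]; last exact: f01.
split=> [j i jn ij|i ni]; last by rewrite etake ltnNge ni.
by rewrite etake (lt_blk j i)// lf//=; case/andP: (f01 i).
Qed.

(** The cone generated by [U_set l], described without a scaling factor.
    Scaling the largest entry to 1 turns the lower bound [1 / l_(j+1)] on block
    [j] into a comparison with all other entries. Membership thus becomes a
    family of non-strict linear inequalities, which survive sums and limits. *)
Definition block_cone n (l : n.+1.-tuple nat) : set E :=
  [set f | (forall i, 0 <= entry f i) /\
    (forall j i i', (j < n)%N -> (block l j <= i < block l j.+1)%N ->
       entry f i' <= (nth 0%N l j.+1)%:R * entry f i)].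

Lemma block_cone0 n (l : n.+1.-tuple nat) : block_cone l 0.
Proof. by split=> [i|j i i' _ _]; rewrite !entry0// mulr0. Qed.

Lemma block_coneD n (l : n.+1.-tuple nat) f g :
  block_cone l f -> block_cone l g -> block_cone l (f + g).
Proof.
move=> [f0 lf] [g0 lg]; split=> [i|j i i' jn ij].
  by rewrite entryD addr_ge0.
by rewrite !entryD mulrDr lerD// (lf j i, lg j i).
Qed.

Lemma block_coneZ n (l : n.+1.-tuple nat) (c : R) f :
  0 <= c -> block_cone l f -> block_cone l (c *: f).
Proof.
move=> c0 [f0 lf]; split=> [i|j i i' jn ij]; first by rewrite entryZ mulr_ge0.
by rewrite !entryZ mulrCA ler_wpM2l// lf.
Qed.

Lemma U_block_cone n (l : n.+1.-tuple nat) : pos_tuple l ->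
  U_set l `<=` block_cone l.
Proof.
move=> lpos f /U_setP[f01 lf]; split=> [i|j i i' jn ij].
  by have /andP[] := f01 i.
have l0 : 0 < (nth 0%N l j.+1)%:R :> R by rewrite ltr0n lpos.
have /andP[_ fi'] := f01 i'; rewrite (le_trans fi')//.
by rewrite -ler_pdivrMl// mulr1 lf.
Qed.

(** A nonzero [f] in the cone is [c] times an element of [U_set l], for [c] its
    largest entry. *)
Lemma block_cone_cc n (l : n.+1.-tuple nat) : pos_tuple l ->
  block_cone l `<=` cc (M_set R n).
Proof.
move=> lpos f [f0 lf].
(* The index set is nonempty even for [f = 0]; the extra index carries the
   entry 0. *)
pose F (i : 'I_(size (f : {poly R})).+1) := entry f i.
case: (@arg_maxP _ _ _ ord0 xpredT F isT) => k _ kmax.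
have fk i : entry f i <= F k.
  have [fi|fi] := leqP (size (f : {poly R})).+1 i; last exact: (kmax (Ordinal fi)).
  by rewrite [entry f i]nth_default ?f0// ltnW.
have [Fk0|Fk0] := eqVneq (F k) 0.
  have -> : f = 0; last exact: cc0.
  by apply: entryP => i; apply/eqP; rewrite entry0 eq_le f0 -Fk0 fk.
have Fk : 0 < F k by rewrite lt_def Fk0 f0.
have -> : f = F k *: ((F k)^-1 *: f) by rewrite scalerA divff// scale1r.
apply: ccZ; first exact: ltW.
exists l; first exact/pos_tupleP.
apply/U_setP; split=> [i|j i jn ij]; rewrite entryZ.
  by rewrite mulr_ge0 ?invr_ge0 ?f0 ?(ltW Fk)//= ler_pdivrMl// mulr1 fk.
have l0 : 0 < (nth 0%N l j.+1)%:R :> R by rewrite ltr0n lpos.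
by rewrite ler_pdivlMl// ler_pdivrMr// mulrC lf.
Qed.

(** For [g] the indicator of the first [block l n.+1] coordinates, moving [f]
    towards [g] keeps the lower bounds on the blocks already constrained, where
    [f <= 1 = g], and makes the entries of one further block, of length [l_n],
    at least [1 / (k + 1)]. So [k + 1] serves as the additional parameter
    [l_(n+1)]. *)
Lemma U_segment n (l : n.+1.-tuple nat) f : pos_tuple l -> U_set l f ->
  exists g : E, forall k, M_set R n.+1 (f + k.+1%:R^-1 *: (g - f)).
Proof.
move=> lpos /U_setP[f01 lf].
pose g : E := \poly_(i < block l n.+1) (1 : R).
have eg i : entry g i = (i < block l n.+1)%N%:R.
  by rewrite [LHS]coef_poly; case: ifP.
exists g => k; set t : R := k.+1%:R^-1.
have t0 : 0 <= t by rewrite invr_ge0.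
have t1 : t <= 1 by rewrite invf_le1// ler1n.
have eb i : entry (f + t *: (g - f)) i =
    (1 - t) * entry f i + t * entry g i.
  by rewrite entryD entryZ entryB mulrBr mulrBl mul1r addrA addrAC.
have [l' lnth llast] : exists2 l' : n.+2.-tuple nat,
    forall j, (j < n.+1)%N -> nth 0%N l' j = nth 0%N l j &
    nth 0%N l' n.+1 = k.+1.
  exists [tuple of rcons l k.+1] => [j jn|] /=; rewrite nth_rcons size_tuple.
    by rewrite jn.
  by rewrite ltnn eqxx.
have lblk := eq_block lnth.
exists l'.
  apply/pos_tupleP => j; rewrite leq_eqVlt => /predU1P[->|jn].
    by rewrite llast.
  by rewrite lnth// lpos.
apply/U_setP; split=> [i|j i jn].
  have /andP[fi0 fi1] := f01 i; rewrite eb.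
  have gi1 : 0 <= entry g i <= 1 by rewrite eg; case: (_ < _)%N; rewrite ?lexx ?ler01.
  have /andP[gi0 gi1'] := gi1.
  rewrite addr_ge0 ?mulr_ge0// ?subr_ge0//=.
  by rewrite -[leRHS](subrK t) lerD// ler_piMr// subr_ge0.
rewrite (lblk _ (ltnW jn)) (lblk _ jn) => ij.
have gi : entry g i = 1.
  by rewrite eg (leq_trans (proj2 (andP ij)))// block_le.
have /andP[fi0 fi1] := f01 i.
have -> : entry (f + t *: (g - f)) i = entry f i + t * (1 - entry f i).
  by rewrite entryD entryZ entryB gi.
have fi1' : 0 <= 1 - entry f i by rewrite subr_ge0.
move: jn; rewrite ltnS leq_eqVlt => /predU1P[jn|jn].
  rewrite jn llast -[X in X <= _]/t -subr_ge0.
  have -> : entry f i + t * (1 - entry f i) - t = (1 - t) * entry f i.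
    by rewrite mulrBr mulr1 mulrBl mul1r addrA addrAC addrK.
  by rewrite mulr_ge0// subr_ge0.
rewrite lnth//.
by rewrite (le_trans (lf j i jn ij))// lerDl mulr_ge0.
Qed.

Lemma cc_M_sub_seq_closure n :
  cc (M_set R n) `<=` seq_closure (cc (M_set R n.+1)).
Proof.
move=> _ [m [c [a [c0 aM ->]]]].
have /choice[g gM] i : exists g : E,
    forall k, M_set R n.+1 (a i + k.+1%:R^-1 *: (g - a i)).
  have [l lpos Ul] := aM i; apply: U_segment Ul; exact/pos_tupleP.
exists (fun k => \sum_i c i *: a i +
    k.+1%:R^-1 *: (\sum_i c i *: g i - \sum_i c i *: a i)); last first.
  exact: cvg_to_segment.
move=> k; rewrite -sumrB scaler_sumr -big_split/=.
apply: cc_sum => i.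
by rewrite -scalerBr scalerA mulrC -scalerA -scalerDr; apply: ccZ.
Qed.

End Blocks.

(** * Sequential closures *)

Section SequentialClosure.
#[local] Set Implicit Arguments.
#[local] Unset Strict Implicit.
Variable R : realType.
Local Notation E := (finSeq R).
Implicit Types (f : E) (n : nat).

(** Passing to one ultrafilter on the index set makes all the bounded
    sequences of entries converge at once, in place of successive extractions
    of subsequences. *)
Lemma ultra_bounded_cvg (T : Type) (G : set_system T) (h : T -> R) (a b : R) :
  UltraFilter G -> (\forall k \near G, a <= h k <= b) ->
  exists p : R, h @ G --> p.
Proof.
move=> UG hab; have PG := @ultra_proper _ _ UG.
have [|p [_ hp]] := @segment_compact R a b (h @ G) _.
  by apply: filterS hab => k; rewrite /= in_itv.
exists p => B Bp; have [//|nB] := in_ultra_setVsetC (h @^-1` B) UG.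
by have [z [nBz Bz]] := hp (~` B) B nB Bp.
Qed.

(** Tuples of bounded positive numbers form a finite type when they are shifted
    down by 1. *)
Definition succ_tuple n N (t : n.-tuple 'I_N) : n.-tuple nat :=
  [tuple of map (S \o val) t].

Lemma succ_tuple_pos n N (t : n.+1.-tuple 'I_N) : pos_tuple (succ_tuple t).
Proof.
by apply/pos_tupleP => i; rewrite tnth_map.
Qed.

Lemma succ_tuple_surj n N m (l : m.+1.-tuple nat) :
  (forall j, (j <= n)%N -> (0 < nth 0%N l j <= N)%N) ->
  exists t : n.+1.-tuple 'I_N.+1,
    forall j, (j <= n)%N -> nth 0%N (succ_tuple t) j = nth 0%N l j.
Proof.
move=> lN; exists [tuple inord (nth 0%N l j).-1 | j < n.+1] => j jn.
rewrite -[j]/(nat_of_ord (Ordinal (jn : (j < n.+1)%N))) -tnth_nth.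
rewrite tnth_map tnth_mktuple /=; have /andP[l0 lj] := lN j jn.
by rewrite inordK prednK// ltnW.
Qed.

(** Let [l] be of level [n + 1]. An element of [U_set l] supported in the first [N] coordinates has
    [block l n.+1 <= N], as the entries of the blocks are nonzero; this leaves
    finitely many choices for [l_0, ..., l_n], whereas [l_(n+1)] is
    unconstrained and gets forgotten. *)
Lemma U_block_cone_bounded n N (l : n.+2.-tuple nat) f :
  pos_tuple l -> U_set l f -> (forall i, (N <= i)%N -> entry f i = 0) ->
  exists t : n.+1.-tuple 'I_N.+1, block_cone (succ_tuple t) f.
Proof.
move=> lpos Uf fN.
have blN : (block l n.+1 <= N)%N.
  rewrite leqNgt; apply/negP => /block_cover[j jn ij].
  have /U_setP[_ /(_ j N jn ij)] := Uf.
  by rewrite fN// leNgt invr_gt0 ltr0n lpos.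
have [|t tl] := @succ_tuple_surj n N _ l.
  move=> j jn; rewrite lpos ?(leqW jn)//=.
  by rewrite (leq_trans _ blN)// leq_nth_block.
exists t; have tblk := @eq_block _ _ (succ_tuple t) l n.+1 tl.
have [f0 lf] := U_block_cone lpos Uf.
split=> [//|j i i' jn]; rewrite (tblk _ (leqW (ltnW jn))) (tblk _ (leqW jn)) => ij.
by rewrite tl// lf// leqW.
Qed.

Lemma cc_M_decomposition n N f : cc (M_set R n.+1) f ->
  (forall i, (N <= i)%N -> entry f i = 0) ->
  exists g : n.+1.-tuple 'I_N.+1 -> E,
    (forall t, block_cone (succ_tuple t) (g t)) /\ f = \sum_t g t.
Proof.
move=> [m [c [a [c0 aM ->]]]] fN.
have a0 k i : 0 <= entry (a k) i.
  by have [l lpos /U_setP[/(_ i)/andP[]]] := aM k.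
apply: (big_ind (fun f : E => exists g : n.+1.-tuple 'I_N.+1 -> E,
  (forall t, block_cone (succ_tuple t) (g t)) /\ f = \sum_t g t)).
- exists (fun=> 0); split=> [t|]; first exact: block_cone0.
  by rewrite big1.
- move=> x y [g [lg ->]] [h [lh ->]]; exists (fun t => g t + h t).
  by rewrite big_split; split=> // t; exact: block_coneD.
move=> k _; have [ck0|ck0] := eqVneq (c k) 0.
  exists (fun=> 0); split=> [t|]; first exact: block_cone0.
  by rewrite ck0 scale0r big1.
have [l /pos_tupleP lpos Ul] := aM k.
have [|t tl] := U_block_cone_bounded (N := N) lpos Ul.
  move=> i /fN; rewrite entry_sum => sum0.
  have : entry (c k *: a k) i = 0.
    by apply: (psumr_eq0P _ sum0) => // j _; rewrite entryZ mulr_ge0.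
  by rewrite entryZ => /eqP; rewrite mulf_eq0 (negbTE ck0) => /eqP.
exists (fun t' => if t' == t then c k *: a k else 0); split=> [t'|].
  by case: eqP => [->|_]; [exact: block_coneZ|exact: block_cone0].
by rewrite -big_mkcond big_pred1_eq.
Qed.

(** By the previous decomposition, the terms of a convergent sequence split
    into a fixed finite number of summands, each in a closed cone. These
    summands are bounded by the terms, and their limits along an ultrafilter
    decompose the limit. *)
Lemma seq_closure_cc_M_sub n :
  seq_closure (cc (M_set R n.+1)) `<=` cc (M_set R n).
Proof.
move=> x [u uM ux]; have [N uN] := cvg_bounded_support ux.
have /choice[g gP] k := cc_M_decomposition (uM k) (uN k).
have g0 k t i : 0 <= entry (g k t) i by have [/(_ t)[]] := gP k.
have gu k t i : entry (g k t) i <= entry (u k) i.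
  have [_ ->] := gP k; rewrite entry_sum (bigD1 t)//= lerDl.
  by apply: sumr_ge0 => *; exact: g0.
have [G [UG ooG]] := @ultraFilterLemma _ (\oo : set_system nat) _.
have PG := @ultra_proper _ _ UG.
have uG i : (fun k => entry (u k) i) @ G --> entry x i.
  move=> A Ax; apply: ooG.
  have : (fun k => entry (u k) i) @ \oo --> entry x i.
    exact: (cvg_comp _ _ ux (@entry_continuous R i x)).
  exact.
have /choice[p gp] (ti : n.+1.-tuple 'I_N.+1 * nat) :
    exists p : R, (fun k => entry (g k ti.1) ti.2) @ G --> p.
  apply: (@ultra_bounded_cvg _ _ _ 0 (entry x ti.2 + 1)).
  have lt_bound : entry x ti.2 < entry x ti.2 + 1 by rewrite ltrDl ltr01.
  apply: filterS (cvgr_le _ (uG ti.2) _ lt_bound) => k uk.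
  by rewrite g0 (le_trans (gu _ _ _)).
pose y t : E := \poly_(i < N) p (t, i).
have gy t i : (fun k => entry (g k t) i) @ G --> entry (y t) i.
  rewrite [entry (y t) i]coef_poly; have [iN|Ni] := ltnP i N.
    exact: (gp (t, i)).
  rewrite (_ : (fun k => _) = fun=> 0); first exact: cvg_cst.
  by apply/funext => k; apply/eqP; rewrite eq_le g0 (le_trans (gu _ _ _)) ?uN.
have -> : x = \sum_t y t.
  apply: entryP => i; rewrite entry_sum.
  apply: (@cvg_unique _ (@Rhausdorff R) _ _ _ _ (uG i)).
  rewrite (_ : (fun k => _) = fun k => \sum_t entry (g k t) i).
    by apply: cvg_big => [|t _]; [exact: add_continuous|exact: gy].
  by apply/funext => k; have [_ ->] := gP k; rewrite entry_sum.
apply: cc_sum => t; apply: (block_cone_cc (succ_tuple_pos t)).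
split=> [i|j i i' jn ij].
  by apply: (cvgr_to_ge (gy t i)); apply: nearW => k; exact: g0.
apply: (ler_cvg_to (gy t i') (cvgMl_tmp (gy t i))).
apply: nearW => k.
by have [/(_ t)[_ /(_ j i i' jn ij)]] := gP k.
Qed.

Lemma seq_closure_cc_M n : seq_closure (cc (M_set R n.+1)) = cc (M_set R n).
Proof.
by apply/seteqP; split; [exact: seq_closure_cc_M_sub|exact: cc_M_sub_seq_closure].
Qed.

Lemma iter_seq_closure_cc_M n k : (k <= n)%N ->
  iter k (@seq_closure (finSeq R)) (cc (M_set R n)) = cc (M_set R (n - k)).
Proof.
elim: k => [|k IH] kn; first by rewrite subn0.
by rewrite iterS IH ?(ltnW kn)// -[(n - k)%N]subSS subSn// seq_closure_cc_M.
Qed.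

Lemma cc_M_nonneg n : cc (M_set R n) `<=` nonneg_orthant R.
Proof.
apply: cc_min => [i|f g f0 g0 i|c f c0 [l _ /U_setP[f01 _]] i].
- by rewrite entry0.
- by rewrite entryD addr_ge0.
- by rewrite entryZ mulr_ge0//; case/andP: (f01 i).
Qed.

Lemma cc_M0 : cc (M_set R 0) = nonneg_orthant R.
Proof.
apply/seteqP; split; first exact: cc_M_nonneg.
move=> f f0; apply: (@block_cone_cc _ _ [tuple 1%N]); last by split.
by case.
Qed.

Lemma cc_M1_neq : cc (M_set R 1) <> nonneg_orthant R.
Proof.
move=> M1.
have : cc (M_set R 1) ('X : {poly R}).
  by rewrite M1 => i; rewrite /entry coefX ler0n.
(* The implication below is preserved by sums as the entries 0 are
   nonnegative, and it fails at [e_1]. *)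
have /[apply] : cc (M_set R 1) `<=`
    [set f : E | 0 <= entry f 0 /\ (entry f 0 = 0 -> entry f 1 = 0)].
  apply: cc_min => [|f g [f0 f1] [g0 g1]|c f c0 [l /pos_tupleP lpos Uf]].
  - by rewrite /= !entry0.
  - rewrite /= !entryD; split; first exact: addr_ge0.
    move=> /eqP; rewrite paddr_eq0// => /andP[/eqP/f1-> /eqP/g1->].
    by rewrite addr0.
  - have [f0 /(_ 0%N 0%N 1%N isT) lf] := U_block_cone lpos Uf.
    rewrite /= !entryZ; split; first exact: mulr_ge0.
    move=> /eqP; rewrite mulf_eq0 => /predU1P[->|/eqP f00]; first by rewrite mul0r.
    have f1 : entry f 1 <= 0.
      rewrite -(mulr0 (nth 0%N l 1)%:R) -f00 lf// blockS /block big_ord0.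
      exact: lpos.
    have /eqP -> : entry f 1 == 0 by rewrite eq_le f1 f0.
    by rewrite mulr0.
by move=> /= []; rewrite /entry !coefX/= => _ /(_ erefl)/eqP; rewrite oner_eq0.
Qed.

Lemma iter_seq_closure_sub (T : topologicalType) (A : set T) k :
  iter k (@seq_closure T) A `<=` closure A.
Proof.
elim: k => [|k IH]; first exact: subset_closure.
move=> x [u uA ux]; apply: closed_closure => B /ux[K _ KB].
by exists (u K); split; [exact: IH (uA K)|exact: (KB K (leqnn K))].
Qed.

Lemma nonneg_orthant_closed : closed (nonneg_orthant R).
Proof.
rewrite (_ : nonneg_orthant R =
    \bigcap_i [set f : E | [set r | 0 <= r] (entry f i)]).
  apply: closed_bigI => i _.
  by apply: closed_comp (@closed_ge R 0) => f _; exact: entry_continuous.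
by apply/seteqP; split=> [f f0 i _|f f0 i]; [exact: f0|exact: f0 i I].
Qed.

End SequentialClosure.

Theorem mainTheorem7 (R : realType) (n : nat) (hn : (1 <= n)%N) :
  let C (k : nat) : set (finSeq R) := iter k (@seq_closure (finSeq R)) (cc (M_set R n)) in
  [/\ C n = closure (cc (M_set R n)),
      closure (cc (M_set R n)) = nonneg_orthant R &
      C n.-1 <> C n].
Proof.
move=> C.
have Cn : C n = nonneg_orthant R.
  by rewrite /C iter_seq_closure_cc_M// subnn cc_M0.
have clC : closure (cc (M_set R n)) = nonneg_orthant R.
  apply/seteqP; split; last by rewrite -Cn; exact: iter_seq_closure_sub.
  rewrite [X in _ `<=` X](closure_id _).1; last exact: nonneg_orthant_closed.
  by apply: closureS; exact: cc_M_nonneg.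
split; rewrite ?clC// Cn /C iter_seq_closure_cc_M ?leq_pred//.
by rewrite -subn1 subKn//; exact: cc_M1_neq.
Qed.
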